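(* Let $\pi:X\to Y$ be a finite ramified covering of smooth projective varieties and let $\Delta(R)$ be the collection of reduced irreducible components of the ramification locus. If $\underline{a}$ is a multiplicity free monomial exponent for $\Delta(R)$ and $R^{\underline{a}}=R_1\cdots R_k$ with $k\ge1$, then $$(-1)^{|\underline{a}|}\sum_{\underline{a}'\le\underline{a},\ |\underline{a}'|\ge1}(-\lambda_{\underline{a}-\underline{a}'}\,\delta_{\underline{a}'})(E_{R^{\underline{a}'}}-1)=\delta_{\underline{a}}\prod_{i=1}^k(1-e_{R_i}).$$
   Context: The ''ramification locus'' is by convention $\pi^{-1}(B)$ with $B$ the branch locus, so $\Delta(R)=\{R_i\}$ is the set of all reduced irreducible components of $\pi^{-1}(B)$, even those along which $\pi$ is unramified. $e_{R_i}$ is the ramification degree of $\pi$ along $R_i$, i.e. the length of $\mathcal{O}_{X,R_i}/J_{\pi(R_i)}\mathcal{O}_{X,R_i}$ with $J_{\pi(R_i)}$ the ideal of $\pi(R_i)$. For a finite collection of divisors $\Delta=\{D_i\}$, a monomial exponent is a vector $\underline{b}=(b_i)$ of non-negative integers indexed by $\Delta$; $|\underline{b}|=\sum_i b_i$, $D^{\underline{b}}=\prod_iD_i^{b_i}$, and $\underline{b}'\le\underline{b}$ means componentwise. The support of $\underline{b}$ is $\{D_i:b_i\neq0\}$. $\underline{b}$ is multiplicity free (MF) if all $b_i\le1$, NMF otherwise. For $\Delta(R)$ write $R^{\underline{a}}=\prod_iR_i^{a_i}$ and $E_{R^{\underline{a}}}=\prod_i(e_{R_i})^{a_i}$. $\delta_{\underline{b}}$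 is the coefficient of the monomial $D^{\underline{b}}$ in $\prod_{D\in\Delta}\frac{D}{1-e^{-D}}$ (the $D$ being treated as formal variables). Further, $$\lambda_{\underline{b}}=\sum_{k\ge0}(-1)^{k+1}\sum_{(\underline{b}_1,\dots,\underline{b}_k)}\prod_{j=1}^k\delta_{\underline{b}_j},$$ the inner sum being over ordered tuples of monomial exponents with $\sum_j\underline{b}_j=\underline{b}$, all $|\underline{b}_j|\ge1$, pairwise disjoint supports, and $\underline{b}_1,\dots,\underline{b}_{k-1}$ MF. In particular $\lambda_{\underline{0}}=-1$. *)

(* Defs.v *)
From HB Require Import structures.
From mathcomp Require Import all_boot all_order all_algebra.
From mathcomp Require Import mpoly.

Set Implicit Arguments.
Unset Strict Implicit.
Unset Printing Implicit Defensive.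

Import Order.TTheory GRing.Theory Num.Theory.

Local Open Scope ring_scope.

(** * Commutative algebra inside a field

    Subrings, ideals and local rings are subsets [F -> Prop] of a field [F],
    compared extensionally. *)

Definition subset_eq (F : Type) (A B : F -> Prop) := forall z, A z <-> B z.
Definition subset_le (F : Type) (A B : F -> Prop) := forall z, A z -> B z.

Section LocalRings.
Variable F : fieldType.
Implicit Types A O I p : F -> Prop.

Definition is_subring A :=
  [/\ A 1, forall x y, A x -> A y -> A (x - y)
    & forall x y, A x -> A y -> A (x * y)].

Definition is_ideal A I :=
  [/\ subset_le I A, I 0, forall x y, I x -> I y -> I (x + y)
    & forall x y, A x -> I y -> I (x * y)].

Definition is_prime A p :=
  [/\ is_ideal A p, ~ p 1
    & forall x y, A x -> A y -> p (x * y) -> p x \/ p y].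

Definition localization A p : F -> Prop :=
  fun z => exists x y, [/\ A x, A y, ~ p y & z = x / y].

(* A point of an integral scheme with function field F is identified with its
   local ring, a subring of F; [in_Spec A O] says that O is the local ring of a
   point of Spec A, for A a subring of F. *)
Definition in_Spec A O :=
  exists p, is_prime A p /\ subset_eq O (localization A p).

(* The nonunits of O, i.e. its maximal ideal when O is local. *)
Definition max_ideal O : F -> Prop :=
  fun z => O z /\ (z = 0 \/ ~ O z^-1).

(* Length of the O-module O / J: the largest m for which there is a strict
   chain I_0 < I_1 < ... < I_m of ideals of O containing J. *)
Definition ideal_chain O (J : F -> Prop) (m : nat) :=
  exists c : nat -> F -> Prop,
    (forall i, (i <= m)%N -> is_ideal O (c i) /\ subset_le J (c i)) /\
    (forall i, (i < m)%N ->
       subset_le (c i) (c i.+1) /\ ~ subset_le (c i.+1) (c i)).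

Definition quotient_length O J (m : nat) :=
  ideal_chain O J m /\ forall m', ideal_chain O J m' -> (m' <= m)%N.

End LocalRings.

(** * Projective varieties

    An integral projective scheme over k is presented as a projective model in
    the sense of Zariski and Samuel (Commutative Algebra II, VI.17): its
    function field K, together with elements t_0, ..., t_N of K that are
    homogeneous coordinates of its generic point. Coordinates vanishing on the
    variety are the t_j = 0. The scheme is the union of the affine charts
    Spec k[t_0/t_j, ..., t_N/t_j] for t_j != 0, as a set of local rings in K. *)

Definition chart_coord (F : fieldType) (N : nat) (t : 'I_N.+1 -> F)
  (j : 'I_N.+1) : 'I_N.+1 -> F := fun i => t i / t j.

Definition generated_ring (k F : fieldType) (iota : {rmorphism k -> F})
  (N : nat) (y : 'I_N -> F) : F -> Prop :=
  fun z => exists p : {mpoly k[N]}, z = mmap iota y p.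

Record proj_variety (k : fieldType) := ProjVariety {
  fun_field : fieldType;
  scalar : {rmorphism k -> fun_field};
  ambient_dim : nat;
  hcoord : 'I_ambient_dim.+1 -> fun_field;
  fun_field_generated : forall z : fun_field,
    exists j x y,
      [/\ hcoord j != 0,
          generated_ring scalar (chart_coord hcoord j) x,
          generated_ring scalar (chart_coord hcoord j) y,
          y != 0 & z = x / y]
}.

Arguments scalar {k} p.
Arguments ambient_dim {k} p.
Arguments hcoord {k} p.

Section Varieties.
Variables (k : fieldType) (X : proj_variety k).

Definition chart_ring (j : 'I_(ambient_dim X).+1) : fun_field X -> Prop :=
  generated_ring (scalar X) (chart_coord (hcoord X) j).

Definition in_chart (j : 'I_(ambient_dim X).+1) (O : fun_field X -> Prop) :=
  hcoord X j != 0 /\ in_Spec (chart_ring j) O.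

Definition is_point (O : fun_field X -> Prop) := exists j, in_chart j O.

Definition alg_indep (d : nat) (s : 'I_d -> fun_field X) :=
  forall p : {mpoly k[d]}, mmap (scalar X) s p = 0 -> p = 0.

(* dim X is the transcendence degree of the function field over k. *)
Definition has_dim (d : nat) :=
  (exists s : 'I_d -> fun_field X, alg_indep s) /\
  ~ (exists s : 'I_d.+1 -> fun_field X, alg_indep s).

(* Jacobian criterion in the chart t_j != 0, a closed subvariety of the affine
   space of dimension N + 1 with coordinates t_i / t_j: there are
   c = (N + 1) - dim X equations vanishing on the variety (i.e. at its generic
   point), and a minor of size c of their Jacobian matrix which does not vanish
   at the given point (i.e. is a unit of its local ring). *)
Definition smooth_at (O : fun_field X -> Prop) :=
  exists (j : 'I_(ambient_dim X).+1) (d c : nat)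
         (f : 'I_c -> {mpoly k[(ambient_dim X).+1]})
         (g : 'I_c -> 'I_(ambient_dim X).+1),
    let y := chart_coord (hcoord X) j in
    [/\ in_chart j O, has_dim d, (c + d = (ambient_dim X).+1)%N,
        forall i, mmap (scalar X) y (f i) = 0
      & ~ max_ideal O
            (\det (\matrix_(i, l) mmap (scalar X) y (mderiv (g l) (f i))))].

Definition smooth := forall O, is_point O -> smooth_at O.

End Varieties.

(** * Finite ramified coverings

    A covering is surjective, hence dominant, and so it is determined by the
    k-embedding of function fields it induces; it sends the point with local
    ring P to the (unique) point whose local ring is dominated by P. *)

Definition dominates (L F : fieldType) (phi : {rmorphism L -> F})
  (Q : L -> Prop) (P : F -> Prop) :=
  (forall z, Q z -> P (phi z)) /\
  (forall z, max_ideal Q z -> max_ideal P (phi z)).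

Definition module_span (L F : fieldType) (phi : {rmorphism L -> F})
  (B : L -> Prop) (m : nat) (g : 'I_m -> F) : F -> Prop :=
  fun z => exists c : 'I_m -> L,
    (forall i, B (c i)) /\ z = \sum_i phi (c i) * g i.

(* Finiteness: the preimage of every chart Spec B of Y is an affine open
   Spec A of X, with A a finitely generated B-module. *)
Record finite_covering (k : fieldType) (X Y : proj_variety k) :=
  FiniteCovering {
    pullback : {rmorphism fun_field Y -> fun_field X};
    pullback_scalar : forall c : k, pullback (scalar Y c) = scalar X c;
    covering_total : forall P, is_point P ->
      exists Q, is_point Q /\ dominates pullback Q P;
    covering_finite : forall j, hcoord Y j != 0 ->
      exists A, [/\ is_subring A,
        exists (m : nat) (g : 'I_m -> fun_field X),
          subset_eq A (module_span pullback (chart_ring j) g)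
      & forall P, in_Spec A P <->
          is_point P /\ exists Q, in_chart j Q /\ dominates pullback Q P]
  }.

Section Ramification.
Variables (k : fieldType) (X Y : proj_variety k) (pi : finite_covering X Y).
Implicit Types (P : fun_field X -> Prop) (Q : fun_field Y -> Prop).

Definition maps_to P Q :=
  [/\ is_point P, is_point Q & dominates (pullback pi) Q P].

(* The ideal of O_{X,P} generated by the maximal ideal of O_{Y,Q}. When P is
   the generic point of R, with image Q, this is J_{pi(R)} O_{X,R}. *)
Definition extended_ideal P Q : fun_field X -> Prop :=
  fun z => exists (m : nat) (c : 'I_m -> fun_field X) (q : 'I_m -> fun_field Y),
    [/\ forall i, P (c i), forall i, max_ideal Q (q i)
      & z = \sum_i c i * pullback pi (q i)].

(* Separability of the residue field extension: every residue class is a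
   simple root of some polynomial with coefficients in the residue field of Q. *)
Definition residually_separable P Q :=
  forall z, P z -> exists f : {poly fun_field Y},
    [/\ forall i, Q f`_i,
        max_ideal P (map_poly (pullback pi) f).[z]
      & ~ max_ideal P (map_poly (pullback pi) f)^`().[z]].

Definition unramified_at P Q :=
  subset_eq (extended_ideal P Q) (max_ideal P) /\ residually_separable P Q.

Definition branch_locus Q := exists P, maps_to P Q /\ ~ unramified_at P Q.

(* The full preimage of the branch locus. *)
Definition ramification_locus P := exists Q, maps_to P Q /\ branch_locus Q.

(* A reduced irreducible component is represented by the local ring of its
   generic point. P specializes to P' exactly when P' is included in P, so the
   generic points of the components are the points of the locus with maximal
   local ring. *)
Definition ramification_component P :=
  ramification_locus P /\
  forall P', ramification_locus P' -> subset_le P P' -> subset_le P' P.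

Definition ramification_divisors (r : nat) (R : 'I_r -> fun_field X -> Prop) :=
  (forall i j, subset_eq (R i) (R j) -> i = j) /\
  (forall P, ramification_component P <-> exists i, subset_eq (R i) P).

Definition ramification_degree P (e : nat) :=
  exists Q, maps_to P Q /\ quotient_length P (extended_ideal P Q) e.

End Ramification.

(** * The coefficients delta and lambda

    A collection of r divisors is indexed by 'I_r, and its monomial exponents
    are the elements of 'X_{1..r}. *)

Definition multiplicity_free (r : nat) (b : 'X_{1..r}) : bool :=
  [forall i, b i <= 1]%N.

Definition disjoint_support (r : nat) (b c : 'X_{1..r}) : bool :=
  [forall i, (b i == 0) || (c i == 0)]%N.

(* Coefficient of x^m in the power series 1 - e^{-x}. *)
Definition one_sub_expN (m : nat) : rat := (m == 0)%:R - (-1) ^+ m / m`!%:R.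

(* The first n coefficients of x / (1 - e^{-x}), by power series division. *)
Fixpoint todd_seq (n : nat) : seq rat :=
  if n is m.+1 then
    let s := todd_seq m in
    rcons s ((m == 0)%:R - \sum_(j < m) s`_j * one_sub_expN (m - j).+1)
  else [::].

Definition todd (n : nat) : rat := (todd_seq n.+1)`_n.

Lemma size_todd_seq n : size (todd_seq n) = n.
Proof. by elim: n => //= n IHn; rewrite size_rcons IHn. Qed.

Lemma nth_todd_seq n j : (j < n)%N -> (todd_seq n)`_j = todd j.
Proof.
elim: n => // n IHn; rewrite ltnS leq_eqVlt => /orP[/eqP-> //|ltjn].
by rewrite /= nth_rcons size_todd_seq ltjn IHn.
Qed.

(* (x / (1 - e^{-x})) (1 - e^{-x}) = x, coefficientwise. *)
Lemma todd_mul n :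
  \sum_(j < n.+1) todd j * one_sub_expN (n - j) = (n == 1)%:R.
Proof.
have q0 : one_sub_expN 0 = 0 by rewrite /one_sub_expN fact0 expr0 divr1 subrr.
have q1 : one_sub_expN 1 = 1.
  by rewrite /one_sub_expN expr1 divr1 sub0r opprK.
rewrite big_ord_recr /= subnn q0 mulr0 addr0.
case: n => [|n]; first by rewrite big_ord0.
rewrite big_ord_recr /= subSnn q1 mulr1 /todd /= nth_rcons size_todd_seq.
rewrite ltnn eqxx eqSS addrC.
rewrite -[RHS](subrK (\sum_(j < n) (todd_seq n)`_j * one_sub_expN (n - j).+1)).
congr (_ + _); apply: eq_bigr => j _.
by rewrite nth_todd_seq // subSn // ltnW.
Qed.

(* Coefficient of D^b in prod_i D_i / (1 - e^{-D_i}); truncating the series at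
   degree |b| in each variable does not affect this coefficient. *)
Definition delta (r : nat) (b : 'X_{1..r}) : rat :=
  (\prod_(i < r) \sum_(m < (mdeg b).+1)
     (todd m *: 'X_i ^+ m : {mpoly rat[r]}))@_b.

(* The condition on the ordered tuples (b_1, ..., b_k) in the sum defining
   lambda_b; they are indexed from 0. *)
Definition lambda_tuple (r k : nat) (b : 'X_{1..r}) (t : 'I_k -> 'X_{1..r}) :=
  [&& (\sum_(j < k) t j)%MM == b,
      [forall j, 0 < mdeg (t j)]%N,
      [forall i, [forall j, (i != j) ==> disjoint_support (t i) (t j)]]
    & [forall j : 'I_k, (j.+1 < k)%N ==> multiplicity_free (t j)]].

(* Every b_j has degree between 1 and |b|, so only k <= |b| contributes. *)
Definition lambda (r : nat) (b : 'X_{1..r}) : rat :=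
  \sum_(k < (mdeg b).+1) (-1) ^+ k.+1 *
    \sum_(t : {ffun 'I_k -> 'X_{1..r < (mdeg b).+1}}
           | lambda_tuple b (fun j => bmnm (t j)))
      \prod_(j < k) delta (bmnm (t j)).

(* The integer E_{R^a}. *)
Definition ram_product (r : nat) (e : 'I_r -> nat) (a : 'X_{1..r}) : nat :=
  (\prod_(i < r) e i ^ a i)%N.

(* Main.v *)
(* On a multiplicity free exponent b of degree n one has delta_b = 2^{-n}, and
   2^n lambda_b is minus the alternating count of the ordered partitions of an
   n-element set, so lambda_b = - (-1/2)^n. Both sides of the identity then
   reduce to the expansion of prod_i (1 - e_i) over the divisors of R^a, the
   contribution of the -1 in E_{R^{a'}} - 1 being prod_i (1 - 1) = 0. *)
Require Import Defs.
From mathcomp Require Import all_boot all_order all_algebra.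
From mathcomp Require Import mpoly.
From mathcomp Require Import ring.

Import GRing.Theory.

Local Open Scope ring_scope.

(** * Sums over the divisors of a monomial *)

Lemma prod_mnm_deg (A : comNzRingType) (r : nat) (x : A) (b : 'X_{1..r}) :
  \prod_(i < r) x ^+ b i = x ^+ mdeg b.
Proof. by rewrite mdegE -expr_sum. Qed.

Lemma leq_mdeg_mnm (r : nat) (a b : 'X_{1..r}) :
  (a <= b)%MM -> (mdeg a <= mdeg b)%N.
Proof. by move=> leab; rewrite -(submK leab) mdegD leq_addl. Qed.

(** Distributivity: expanding the product of sums gives a sum over functions ['I_r -> 'I_N] bounded
    by [b], and [mdeg b < N] makes these correspond bijectively to the exponents below [b]. *)
Lemma sum_submonomials (A : comNzRingType) (r N : nat) (b : 'X_{1..r})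
    (F : 'I_r -> nat -> A) : (mdeg b < N)%N ->
  \sum_(a : 'X_{1..r < N} | (a <= b)%MM) \prod_(i < r) F i (a i)
  = \prod_(i < r) \sum_(m < N | (m <= b i)%N) F i m.
Proof.
move=> ltbN.
rewrite (bigA_distr_big_dep (fun i (m : 'I_N) => (m <= b i)%N)).
have exp_lt (a : 'X_{1..r < N}) i : (a i < N)%N.
  by apply: leq_ltn_trans (bmdeg a); rewrite mdegE (bigD1 i) //= leq_addr.
pose to_fun (a : 'X_{1..r < N}) := [ffun i => Ordinal (exp_lt a i)].
have N0 : (mdeg (0%MM : 'X_{1..r}) < N)%N by rewrite mdeg0 (leq_ltn_trans _ ltbN).
(* The default value [BMultinom N0] is only reached by functions of total degree at least [N], hence
   never by one bounded by [b]. *)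
pose of_fun (f : {ffun 'I_r -> 'I_N}) : 'X_{1..r < N} :=
  insubd (BMultinom N0) [multinom (f i : nat) | i < r].
rewrite [RHS](reindex_onto to_fun of_fun) /=.
  apply: eq_big => [a|a _]; last by apply: eq_bigr => i _; rewrite ffunE.
  have -> : of_fun (to_fun a) == a.
    apply/eqP/val_inj; rewrite val_insubd.
    have -> : [multinom (to_fun a i : nat) | i < r] = bmnm a.
      by apply/mnmP => i; rewrite mnmE ffunE.
    by rewrite bmdeg.
  rewrite andbT; apply/mnm_lepP/familyP => [le i|fam i].
    by rewrite ffunE unfold_in /= le.
  by have := fam i; rewrite ffunE unfold_in.
move=> f /familyP fam; apply/ffunP => i; apply: val_inj.
rewrite ffunE /= val_insubd ifT ?mnmE //.
apply: leq_ltn_trans ltbN; apply: leq_mdeg_mnm; apply/mnm_lepP => j.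
by rewrite mnmE; apply: fam.
Qed.

Section MultiplicityFree.
Variable r : nat.
Implicit Types a b : 'X_{1..r}.

Lemma multiplicity_free_le a b :
  (a <= b)%MM -> multiplicity_free b -> multiplicity_free a.
Proof.
move=> /mnm_lepP leab /forallP bMF; apply/forallP => i.
exact: leq_trans (leab i) (bMF i).
Qed.

(** Each variable occurs with exponent 0 or 1, so its factor is [1 + x i] on the support of [b] and
    1 elsewhere. *)
Lemma sum_submonomials_MF (A : comNzRingType) (N : nat) b (x : 'I_r -> A) :
  (mdeg b < N)%N -> multiplicity_free b ->
  \sum_(a : 'X_{1..r < N} | (a <= b)%MM) \prod_(i < r) x i ^+ a i
  = \prod_(i < r | b i != 0%N) (1 + x i).
Proof.
move=> ltbN /forallP bMF.
rewrite (@sum_submonomials _ _ _ _ (fun i m => x i ^+ m)) //.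
rewrite [RHS]big_mkcond; apply: eq_bigr => i _.
have ltbiN : (b i < N)%N.
  by apply: leq_ltn_trans ltbN; rewrite mdegE (bigD1 i) //= leq_addr.
rewrite -(big_mkord (fun m => m <= b i)%N (fun m => x i ^+ m)).
rewrite (big_cat_nat (n := (b i).+1)) //= [X in _ + X]big1_seq; last first.
  by move=> m /andP[le_m]; rewrite mem_index_iota ltnNge le_m.
rewrite addr0 big_mkord big_mkcond /=.
have := bMF i; case: (b i) => [|[|//]] _ /=.
  by rewrite big_ord_recl big_ord0 addr0.
by rewrite !big_ord_recl big_ord0 addr0.
Qed.

(** This is the expansion at [x i = -1]: any divisor in the support contributes a factor [1 - 1]. *)
Lemma alternating_sum_submonomials (A : comNzRingType) (N : nat) b :
  (mdeg b < N)%N -> multiplicity_free b ->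
  \sum_(a : 'X_{1..r < N} | (a <= b)%MM) (-1) ^+ mdeg a = (b == 0%MM)%:R :> A.
Proof.
move=> ltbN bMF; under eq_bigr do rewrite -prod_mnm_deg.
rewrite (@sum_submonomials_MF _ _ _ (fun=> -1)) //.
have [->|b_neq0] := eqVneq b 0%MM.
  by rewrite big1 // => i; rewrite mnm0E.
have [i bi_neq0] : exists i, b i != 0%N.
  apply/existsP; apply: contraNT b_neq0; rewrite negb_exists => /forallP b0.
  by apply/eqP/mnmP => i; rewrite mnm0E; apply/eqP; rewrite -[_ == _]negbK b0.
by rewrite (bigD1 i) //= subrr mul0r.
Qed.

(** * The coefficients [delta] of multiplicity free exponents *)

Lemma deltaE b : delta b = \prod_(i < r) todd (b i).
Proof.
rewrite /delta bigA_distr_bigA /= raddf_sum /=.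
have exp_lt i : (b i < (mdeg b).+1)%N.
  by rewrite ltnS mdegE (bigD1 i) //= leq_addr.
have coefE (f : {ffun 'I_r -> 'I_(mdeg b).+1}) :
    (\prod_(i < r) (todd (f i) *: 'X_i ^+ f i : {mpoly rat[r]}))@_b
    = \prod_(i < r) todd (f i) * ([multinom (f i : nat) | i < r] == b)%:R.
  rewrite scaler_prod mcoeffZ -mcoeffX mpolyXE_id; congr (_ * _@__).
  by apply: eq_bigr => i _; rewrite mnmE.
under eq_bigr do rewrite coefE.
(* Only the choice of the power [b i] in every factor produces the monomial [b], and the truncation
   at degree [mdeg b] retains it. *)
rewrite (bigD1 [ffun i => Ordinal (exp_lt i)]) //= [X in _ + X]big1 => [|f].
  rewrite addr0 (_ : _ == b); last first.
    by apply/eqP/mnmP => i; rewrite mnmE ffunE.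
  by rewrite mulr1; apply: eq_bigr => i _; rewrite ffunE.
move=> neq; rewrite (negbTE (_ : _ != b)) ?mulr0 //.
apply: contraNneq neq => /mnmP fE; apply/eqP/ffunP => i.
by apply: val_inj; rewrite ffunE /= -fE mnmE.
Qed.

Lemma todd0 : todd 0 = 1.
Proof.
have : todd 0 * one_sub_expN 1 + (todd 1 * one_sub_expN 0 + 0) = 1.
  by rewrite -[RHS](todd_mul 1) !big_ord_recl big_ord0.
rewrite /one_sub_expN fact0 (factS 0) fact0 /= => eq1.
by apply: etrans eq1; field.
Qed.

Lemma todd1 : todd 1 = 2^-1.
Proof.
have : todd 0 * one_sub_expN 2
    + (todd 1 * one_sub_expN 1 + (todd 2 * one_sub_expN 0 + 0)) = 0.
  by rewrite -[RHS](todd_mul 2) !big_ord_recl big_ord0.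
rewrite todd0 /one_sub_expN (factS 1) (factS 0) fact0 /= => eq0.
(* The coefficient of x^2 reads [- todd 0 / 2 + todd 1 = 0], since [one_sub_expN 0] vanishes. *)
by rewrite -[RHS]addr0 -[X in _ + X]eq0; field.
Qed.

Lemma delta_MF b : multiplicity_free b -> delta b = 2^-1 ^+ mdeg b.
Proof.
move=> /forallP bMF; rewrite deltaE -prod_mnm_deg; apply: eq_bigr => i _.
by have := bMF i; case: (b i) => [|[|//]] _; rewrite ?todd0 ?todd1.
Qed.

(** * Ordered compositions of an exponent *)

Definition composition (N k : nat) b (t : {ffun 'I_k -> 'X_{1..r < N}}) :=
  ((\sum_(j < k) bmnm (t j))%MM == b) && [forall j, 0 < mdeg (t j)]%N.

Definition compositions (N k : nat) b : rat :=
  \sum_(t : {ffun 'I_k -> 'X_{1..r < N}} | composition N k b t) 1.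

Lemma compositions0 N b : compositions N 0 b = (b == 0%MM)%:R.
Proof.
rewrite /compositions (eq_bigl (fun=> b == 0%MM)) => [|t]; last first.
  rewrite /composition big_ord0 eq_sym andb_idr // => _.
  by apply/forallP; case.
case: (b == 0%MM); last by rewrite big_pred0.
by rewrite sumr_const card_ffun card_ord expn0.
Qed.

(** Splitting off the first entry [a] leaves a composition of [b - a] into [k] entries; [cons] and
    [uncons] realise this bijection. *)
Lemma compositionsS N k b :
  compositions N k.+1 b
  = \sum_(a : 'X_{1..r < N} | (a <= b)%MM && (0 < mdeg a)%N)
      compositions N k (b - a)%MM.
Proof.
pose cons (p : 'X_{1..r < N} * {ffun 'I_k -> 'X_{1..r < N}}) :
    {ffun 'I_k.+1 -> 'X_{1..r < N}} :=
  [ffun j => if unlift ord0 j is Some j' then p.2 j' else p.1].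
pose uncons (t : {ffun 'I_k.+1 -> 'X_{1..r < N}}) :=
  (t ord0, [ffun j => t (lift ord0 j)]).
rewrite pair_big_dep /= /compositions (reindex_onto cons uncons) /=; last first.
  move=> t _; apply/ffunP => j; rewrite ffunE.
  by case: unliftP => [j'|] -> //; rewrite ffunE.
apply: eq_bigl => -[a t] /=.
have cons0 : cons (a, t) ord0 = a by rewrite ffunE unlift_none.
have consS j : cons (a, t) (lift ord0 j) = t j by rewrite ffunE liftK.
have -> : uncons (cons (a, t)) == (a, t).
  by apply/eqP; congr (_, _) => //; apply/ffunP => j; rewrite ffunE consS.
rewrite andbT /composition big_ord_recl cons0.
under eq_bigr do rewrite consS.
have -> : [forall j, 0 < mdeg (cons (a, t) j)]%N
    = (0 < mdeg a)%N && [forall j, 0 < mdeg (t j)]%N.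
  apply/forallP/andP => [pos|[pos_a /forallP pos] j].
    split; first by have := pos ord0; rewrite cons0.
    by apply/forallP => j; have := pos (lift ord0 j); rewrite consS.
  by case: (unliftP ord0 j) => [j'|] ->; rewrite ?cons0 ?consS.
rewrite [RHS]andbACA; congr (_ && _); set s := (\sum_(j < k) _)%MM.
apply/eqP/andP => [<-|[leab /eqP ->]].
  by rewrite lem_addr addmC addmK eqxx.
by rewrite addmC submK.
Qed.

(** Write S(b) for the sum. Splitting off first entries gives S(b) = [b = 0] - sum of S(b - a) over
    nonzero a <= b, which the signs (-1)^|b| satisfy because the alternating sum over all divisors
    of b is [b = 0]. The bound [mdeg b < K] lets every possible length occur. *)
Lemma alternating_sum_compositions (N K : nat) b :
  (mdeg b < N)%N -> (mdeg b < K)%N -> multiplicity_free b ->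
  \sum_(k < K) (-1) ^+ k * compositions N k b = (-1) ^+ mdeg b.
Proof.
elim: K b => // K IHK b ltbN ltbK bMF.
rewrite big_ord_recl expr0 mul1r compositions0.
under eq_bigr do rewrite lift0 exprS compositionsS -mulrA mulr_sumr.
rewrite -mulr_sumr exchange_big /=.
have step (a : 'X_{1..r < N}) : (a <= b)%MM && (0 < mdeg a)%N ->
    \sum_(k < K) (-1) ^+ k * compositions N k (b - a)%MM
    = (-1) ^+ mdeg b * (-1) ^+ mdeg a.
  move=> /andP[leab a_gt0].
  have degE : mdeg b = (mdeg (b - a)%MM + mdeg a)%N by rewrite -mdegD submK.
  have le : ((b - a)%MM <= b)%MM by apply/mnm_lepP => i; rewrite mnmBE leq_subr.
  rewrite IHK; first by rewrite degE exprD -mulrA -expr2 sqrr_sign mulr1.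
  - exact: leq_ltn_trans (leq_mdeg_mnm _ _ _ le) ltbN.
  - by rewrite -ltnS (leq_trans _ ltbK) // ltnS degE -addn1 leq_add2l.
  - exact: multiplicity_free_le le bMF.
rewrite (eq_bigr _ step) -mulr_sumr.
have := alternating_sum_submonomials rat N b ltbN bMF.
have N0 : (mdeg (0%MM : 'X_{1..r}) < N)%N by rewrite mdeg0 (leq_ltn_trans _ ltbN).
(* The term [a = 0] is isolated, so that the sum over nonzero [a] equals [b = 0] - 1. *)
rewrite (bigD1 (BMultinom N0)) /=; last by apply/mnm_lepP => i; rewrite mnm0E.
rewrite mdeg0 expr0 => sumE.
rewrite (eq_bigl (fun a : 'X_{1..r < N} => (a <= b)%MM && (a != BMultinom N0)))
  => [|a]; last by rewrite lt0n mdeg_eq0.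
rewrite -[X in _ * (_ * X)](addKr 1) sumE.
by have [->|_] := eqVneq b 0%MM; rewrite ?mdeg0 /=; [ring | set s := _ ^+ mdeg b; ring].
Qed.

(** Entries summing to a multiplicity free [b] divide it, so they are multiplicity free; a divisor
    shared by two of them would have exponent at least 2 in [b]. *)
Lemma lambda_tuple_MF (N k : nat) b (t : {ffun 'I_k -> 'X_{1..r < N}}) :
  multiplicity_free b ->
  lambda_tuple b (fun j => bmnm (t j)) = composition N k b t.
Proof.
move=> bMF; rewrite /lambda_tuple /composition.
case: eqP => //= sum_t; case: forallP => //= _.
apply/andP; split; last first.
  apply/forallP => j; apply/implyP => _; apply: multiplicity_free_le bMF.
  by rewrite -sum_t (bigD1 j) //= lem_addr.
apply/forallP => i; apply/forallP => j; apply/implyP => neq_ij.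
apply/forallP => l; move/forallP: bMF => /(_ l).
rewrite -sum_t (bigD1 i) //= (bigD1 j) 1?eq_sym //= !mnmDE.
by case: (bmnm (t i) l) => //= m; case: (bmnm (t j) l) => //= m'; rewrite !addSn !addnS.
Qed.

(** By additivity of the degree, every composition of [b] has the same product of [delta] values,
    2^(-|b|); what remains is the alternating count. *)
Lemma lambda_MF b : multiplicity_free b -> lambda b = - (- 2^-1) ^+ mdeg b.
Proof.
move=> bMF; rewrite /lambda.
have inner N k :
    \sum_(t : {ffun 'I_k -> 'X_{1..r < N}}
           | lambda_tuple b (fun j => bmnm (t j)))
      \prod_(j < k) delta (bmnm (t j))
    = compositions N k b * 2^-1 ^+ mdeg b.
  rewrite /compositions mulr_suml; apply: eq_big => [t|t].
    exact: lambda_tuple_MF.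
  rewrite lambda_tuple_MF // => /andP[/eqP sum_t _]; rewrite mul1r.
  rewrite -[in RHS]sum_t mdeg_sum expr_sum; apply: eq_bigr => j _.
  apply: delta_MF; apply: multiplicity_free_le bMF.
  by rewrite -sum_t (bigD1 j) //= lem_addr.
under eq_bigr do rewrite inner exprS mulN1r mulNr mulrA.
rewrite sumrN -mulr_suml alternating_sum_compositions //.
by rewrite [in RHS]exprNn.
Qed.

End MultiplicityFree.

Theorem proposition5p3 (k : fieldType) (X Y : proj_variety k)
  (smooth_X : smooth X) (smooth_Y : smooth Y) (pi : finite_covering X Y)
  (r : nat) (R : 'I_r -> fun_field X -> Prop)
  (R_components : ramification_divisors pi R)
  (e : 'I_r -> nat) (e_degree : forall i, ramification_degree pi (R i) (e i))
  (a : 'X_{1..r}) (a_MF : multiplicity_free a) (a_gt0 : (1 <= mdeg a)%N) :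
  (-1) ^+ mdeg a *
    \sum_(a' : 'X_{1..r < (mdeg a).+1} | (a' <= a)%MM && (1 <= mdeg a')%N)
      (- lambda (a - a')%MM * delta a') * ((ram_product e a')%:R - 1)
  = delta a * \prod_(i < r | a i != 0%N) (1 - (e i)%:R) :> rat.
Proof.
rewrite -(sum_submonomials_MF r rat (mdeg a).+1 a (fun i => - (e i)%:R)) //.
(* The subtracted 0 is written as the alternating sum over the divisors of [a], which vanishes as
   [a] is nonzero; it matches the -1 in E - 1 term by term. *)
rewrite -[X in _ = _ * X]subr0.
have sum0 : \sum_(a' : 'X_{1..r < (mdeg a).+1} | (a' <= a)%MM) (-1) ^+ mdeg a'
    = 0 :> rat.
  by rewrite alternating_sum_submonomials // -mdeg_eq0 -[_ == _]negbK -lt0n a_gt0.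
rewrite -[X in _ - X]sum0 -sumrB !mulr_sumr big_mkcondr; apply: eq_bigr => a' le_a'a.
have -> : \prod_(i < r) (- (e i)%:R) ^+ a' i
    = (-1) ^+ mdeg a' * (ram_product e a')%:R :> rat.
  rewrite /ram_product natr_prod -prod_mnm_deg -big_split; apply: eq_bigr => i _.
  by rewrite exprNn natrX.
(* The term [a' = 0], excluded on the left, is 1 - 1 = 0 on the right. *)
have [a'_gt0|] := ltnP 0 (mdeg a'); last first.
  rewrite leqn0 mdeg_eq0 => /eqP ->.
  rewrite mdeg0 /ram_product big1 => [|i _]; first by rewrite mulr1 subrr mulr0.
  by rewrite mnm0E.
have degE : mdeg a = (mdeg (a - a')%MM + mdeg a')%N by rewrite -mdegD submK.
rewrite lambda_MF; last first.
  by apply: multiplicity_free_le _ _ _ _ a_MF; apply/mnm_lepP => i; rewrite mnmBE leq_subr.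
rewrite !delta_MF //; last exact: multiplicity_free_le _ _ _ le_a'a a_MF.
move: (mdeg a') (mdeg (a - a')%MM) (ram_product e a') degE => m n E ->.
(* With m = |a'| and n = |a - a'|, the left term carries the sign (-1)^(n+m) (-1)^n and the right
   one (-1)^m; they differ by this square. *)
have sign_sq : (-1) ^+ n * (-1) ^+ n = 1 :> rat by rewrite -expr2 sqrr_sign.
rewrite opprK !exprD (exprNn 2^-1) -[RHS]mul1r -[X in _ = X * _]sign_sq.
set u := (-1) ^+ n; set v := (-1) ^+ m; ring.
Qed.
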